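(* Let $m\ge 1$ and let $s_{\min},s_{\max}$ be integers with $0\le s_{\min}\le s_{\max}\le m-1$. For the complete--$S$ pliable index coding (PICOD) problem with $m$ messages and $S=[s_{\min}:s_{\max}]=\{s_{\min},s_{\min}+1,\dots,s_{\max}\}$, the optimal (normalized) code length is $$\ell^*=\min\{m-s_{\min},\; s_{\max}+1\},$$ and this optimal length is achieved by linear codes.
   Context: PICOD problem: a single server holds $m$ independent messages $w_1,\dots,w_m$, each uniformly distributed over binary strings of $k$ bits; write $W=\{w_1,\dots,w_m\}$ and, for $A\subseteq[m]$, $W_A=\{w_a: a\in A\}$. There are $n$ users $u_1,\dots,u_n$; user $u_j$ has side information $W_{A_j}$ for a known set $A_j\subset[m]$. The server broadcasts over a noiseless channel a codeword $x^{\ell k}=\mathsf{ENC}(W)$ of $\ell k$ bits (the encoder may depend on the globally known collection $\{A_1,\dots,A_n\}$). User $u_j$ applies a decoder $\widehat w_j=\mathsf{DEC}_j(W_{A_j},x^{\ell k})$. A code is valid if for every user $u_j$ there exists an index $d_j\in[m]\setminus A_j$ (the desired message, which may be chosen freely as part of the code design) such that $\Pr[\widehat w_j\neq w_{d_j}]\le\epsilon$. The optimal code length $\ell^*$ is the smallest $\ell$ such that a valid code of length $\ell k$ bits exists for some message length $k$. The complete--$S$ PICOD with $m$ messages, for $S\subseteq[0:m-1]$, is the PICOD instance with $n=\sum_{s\in S}\binom{m}{s}$ users whose side information sets are exactly all the distinct subsets of $[m]$ whose cardinality lies in $S$ (each such subset is the side information set of exactly one user). A linear code is one in which the transmitted bits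 are linear functions (over a finite field) of the message bits. *)

(* Defs.v *)
From HB Require Import structures.
From mathcomp Require Import all_boot all_order all_algebra.
Set Implicit Arguments. Unset Strict Implicit. Unset Printing Implicit Defensive.
Import Order.TTheory GRing.Theory Num.Theory.
Local Open Scope ring_scope.

Notation bit := 'F_2.

(* The full message set W = (w_1,...,w_m): row i of the matrix is the
   k-bit message w_i. *)
Definition msgs (m k : nat) := 'M[bit]_(m, k).

Definition codeword (L : nat) := 'rV[bit]_L.

Definition completeS_users (m : nat) (smin smax : nat) : pred {set 'I_m} :=
  fun A => (smin <= #|A| <= smax)%N.

Definition uses_only_side_info (m k L : nat) (A : {set 'I_m})
  (dec : msgs m k -> codeword L -> 'rV[bit]_k) : Prop :=
  forall (W W' : msgs m k) (x : codeword L),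
    (forall a : 'I_m, a \in A -> row a W = row a W') -> dec W x = dec W' x.

(* Error probability of a user (messages uniform over all (2^k)^m tuples),
   decoding desired message index d. *)
Definition err_prob (m k L : nat) (enc : msgs m k -> codeword L)
  (dec : msgs m k -> codeword L -> 'rV[bit]_k) (d : 'I_m) : rat :=
  (#|[set W : msgs m k | dec W (enc W) != row d W]|%:R / (2 ^ (m * k))%:R)%R.

(* A valid PICOD code with error at most eps for the instance whose users
   are the side information sets satisfying [users]: the desired message
   d A of each user (chosen freely by the code designer) is not in A, the
   decoder only uses (W_A, x), and the error probability is <= eps. *)
Definition valid_code (m k L : nat) (users : pred {set 'I_m}) (eps : rat)
  (enc : msgs m k -> codeword L) : Prop :=
  exists (dec : {set 'I_m} -> msgs m k -> codeword L -> 'rV[bit]_k)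
         (d : {set 'I_m} -> 'I_m),
    forall A : {set 'I_m}, users A ->
      [/\ d A \notin A, uses_only_side_info A (dec A)
        & err_prob enc (dec A) (d A) <= eps].

Definition achievable (m : nat) (users : pred {set 'I_m}) (ell : rat) : Prop :=
  forall eps : rat, 0 < eps ->
    exists (k L : nat) (enc : msgs m k -> codeword L),
      (0 < k)%N /\ (L%:R <= ell * k%:R) /\ valid_code users eps enc.

Definition linear_enc (m k L : nat) (enc : msgs m k -> codeword L) : Prop :=
  forall (a : bit) (W1 W2 : msgs m k), enc (a *: W1 + W2) = a *: enc W1 + enc W2.

(* Main.v *)
(** Converse. Let a user's decoded index d(A) be viewed as a closure rule: X is closed
    if it contains d(A) for every user A included in X. No closed set has size in [smin, smax], because a user
    with that side information would decode something outside of it. The point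
    is that some set of at most max(smin, m - smax - 1) messages generates
    everything; giving these messages away, the codeword determines all others.
    For a minimal generating set C this is an extremal statement on the maximal
    proper closed sets containing C \ c, of the same kind as Tits' bound for
    Steiner systems and Fisher's inequality, and it is proved by induction and
    a weighted double count.

    Achievability. Over a field of characteristic 2 with at least m elements, a
    Vandermonde code of length m - smin lets a user with smin messages decode
    the remaining ones; among smax + 1 uncoded messages there is always one that
    a given user lacks. *)

Require Import Defs.
From HB Require Import structures.
From mathcomp Require Import all_boot all_order all_algebra.
From mathcomp Require Import all_field zify.
Import Order.TTheory GRing.Theory Num.Theory.
Import VectorInternalTheory.
Local Open Scope ring_scope.
Set Implicit Arguments. Unset Strict Implicit. Unset Printing Implicit Defensive.

(** * Weighted counting in a bipartite relation *)

Definition common_nbrs (I J : finType) (r : I -> J -> bool) (T : {set J})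
  (D : {set I}) : {set J} := [set x in T | [forall (c | c \in D), r c x]].

Lemma common_nbrsP (I J : finType) (r : I -> J -> bool) (T : {set J})
  (D : {set I}) (x : J) :
  reflect (x \in T /\ forall c, c \in D -> r c x) (x \in common_nbrs r T D).
Proof.
rewrite inE; apply: (iffP andP) => -[xT xD]; split=> //; first by move/forall_inP: xD.
exact/forall_inP.
Qed.

(** Give each edge (c, x) weight 1 / deg c, for a total of [#|C|]. A vertex x receives at most deg x
    / (deg x + j), which is at most 1 - j / [#|T|]. *)
Lemma card_le_of_degree (I J : finType) (r : I -> J -> bool) (j : nat)
  (C : {set I}) (T : {set J}) :
  (j <= #|T|)%N ->
  (forall c, c \in C -> (0 < #|[set x in T | r c x]|)%N) ->
  (forall c x, c \in C -> x \in T -> r c x ->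
     (#|[set e in C | r e x]| + j <= #|[set x in T | r c x]|)%N) ->
  (#|C| + j <= #|T|)%N.
Proof.
move=> lejT Mgt0 degM; case: (posnP #|T|) => [T0|Tgt0].
  have [->|[c cC]] := set_0Vmem C; first by rewrite cards0.
  have := Mgt0 c cC; rewrite lt0n cards_eq0; case/set0Pn=> x.
  by rewrite inE (cards0_eq T0) inE.
have tpos : 0 < #|T|%:R :> rat by rewrite ltr0n.
rewrite -(ler_nat rat) natrD -lerBrDr.
have -> : #|C|%:R = \sum_(c in C) \sum_(x in T | r c x)
    (#|[set y in T | r c y]|%:R)^-1 :> rat.
  rewrite -sum1_card natr_sum; apply: eq_bigr => c cC.
  rewrite (eq_bigl [in [set x in T | r c x]]) => [|x]; last by rewrite inE.
  rewrite sumr_const -[RHS]mulr_natl mulfV //.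
  by rewrite pnatr_eq0 -lt0n Mgt0.
have -> : #|T|%:R - j%:R = \sum_(x in T) (1 - j%:R / #|T|%:R) :> rat.
  rewrite sumr_const -[RHS]mulr_natl mulrBr mulr1 mulrCA mulfV ?mulr1 //.
  by rewrite lt0r_neq0.
rewrite (exchange_big_dep (mem T)) //=; last by move=> c x _ /andP[].
apply: ler_sum => x xT.
set deg := #|[set e in C | r e x]|.
have [deg0|deggt0] := posnP deg.
  rewrite big1 => [|c /and3P[cC _ rcx]]; last first.
    by move: (cards0_eq deg0) => /setP/(_ c); rewrite !inE cC rcx.
  by rewrite subr_ge0 ler_pdivrMr // mul1r ler_nat.
have dj : 0 < (deg + j)%:R :> rat by rewrite ltr0n addn_gt0 deggt0.
apply: (@le_trans _ _ (\sum_(c in C | r c x) ((deg + j)%:R)^-1)).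
  rewrite (eq_bigl (fun c => (c \in C) && r c x)) => [|c]; last by rewrite xT.
  apply: ler_sum => c /andP[cC rcx].
  by rewrite lef_pV2 ?posrE // ?ler_nat ?degM // ltr0n Mgt0.
rewrite (eq_bigl [in [set e in C | r e x]]) => [|e]; last by rewrite inE.
rewrite sumr_const -/deg.
have degjT : (deg + j <= #|T|)%N.
  move: deggt0; rewrite card_gt0 => /set0Pn[c]; rewrite inE => /andP[cC rcx].
  apply: leq_trans (degM c x cC xT rcx) _; apply: subset_leq_card.
  by apply/subsetP=> y; rewrite inE => /andP[].
rewrite -[leLHS]mulr_natl lerBrDr.
apply: (@le_trans _ _ (deg%:R / (deg + j)%:R + j%:R / (deg + j)%:R)).
  by rewrite lerD2l ler_wpM2l ?ler0n // lef_pV2 ?posrE // ler_nat.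
by rewrite -mulrDl -natrD mulfV // lt0r_neq0.
Qed.

(* For [x] adjacent to [c], the induction hypothesis applied to the other
   neighbours of [x] and to the other neighbours of [c] gives
   deg x + j <= deg c; then count the edges (c, x) with weight 1 / deg c. *)
Lemma card_le_of_common_nbrs (I J : finType) (r : I -> J -> bool) (j : nat)
  (C : {set I}) (T : {set J}) :
  C != set0 ->
  (forall D : {set I}, D \subset C -> D != set0 ->
     ~~ (#|D| <= (#|common_nbrs r T D|).+1 <= #|D| + j)%N) ->
  (#|C| + j <= #|T|)%N.
Proof.
have [n] := ubnP #|C|.
elim: n C T => [|n IH] C T lCn C0 avoid.
  by [].
have nbrs1 c : common_nbrs r T [set c] = [set x in T | r c x].
  apply/setP=> x; rewrite [RHS]inE; apply/common_nbrsP/andP => -[xT H]; split=> //.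
    by apply: H; rewrite set11.
  by move=> e /set1P ->.
have Mj c : c \in C -> (j < #|[set x in T | r c x]|)%N.
  move=> cC; have := avoid [set c]; rewrite sub1set cC nbrs1 cards1.
  have -> : [set c] != set0 by apply/set0Pn; exists c; rewrite set11.
  by move=> /(_ isT isT); lia.
apply: (@card_le_of_degree _ _ r) => [|c cC|c x cC xT rcx].
- have /set0Pn[c cC] := C0; apply: leq_trans (ltnW (Mj c cC)) _.
  by apply: subset_leq_card; apply/subsetP=> y; rewrite inE => /andP[].
- exact: leq_ltn_trans (Mj c cC).
set Cx := [set e in C | r e x]; set Mc := [set y in T | r c y].
have cCx : c \in Cx by rewrite inE cC.
have xMc : x \in Mc by rewrite inE xT.
have Hc := cardsD1 c Cx; rewrite cCx in Hc.
have Hx := cardsD1 x Mc; rewrite xMc in Hx.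
have [E|Cx0] := eqVneq (Cx :\ c) set0.
  by have := Mj c cC; rewrite -/Mc Hc E cards0; lia.
have sub : Cx \subset C by apply/subsetP=> e; rewrite inE => /andP[].
suff : (#|Cx :\ c| + j <= #|Mc :\ x|)%N by lia.
apply: IH Cx0 _ => [|D DC D0].
  have := subset_leq_card sub; lia.
have /subsetP DCx := subset_trans DC (subsetDl _ _).
have cD : c \notin D by apply/negP=> /(subsetP DC); rewrite !inE eqxx.
(* Adding c to D and putting x back raises both cardinalities by one, so the forbidden window keeps
   its form. *)
have := avoid (c |: D).
have -> : c |: D \subset C.
  rewrite subUset sub1set cC; apply: subset_trans sub; exact/subsetP.
have -> : c |: D != set0 by apply/set0Pn; exists c; rewrite setU11.
move=> /(_ isT isT); rewrite cardsU1 cD.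
have -> : common_nbrs r (Mc :\ x) D = common_nbrs r T (c |: D) :\ x.
  apply/setP=> y; rewrite in_setD1; apply/common_nbrsP/andP.
    case=> /setD1P[yx /setIdP[yT rcy]] H; split=> //.
    apply/common_nbrsP; split=> // e /setU1P[->|] //; exact: H.
  case=> yx /common_nbrsP[yT H]; rewrite !inE yx yT H ?setU11 //; split=> // e eD.
  by apply: H; rewrite inE eD orbT.
have xM : x \in common_nbrs r T (c |: D).
  apply/common_nbrsP; split=> // e; rewrite !inE => /orP[/eqP->|] //.
  by move/DCx; rewrite inE => /andP[].
have := cardsD1 x (common_nbrs r T (c |: D)); rewrite xM; lia.
Qed.

Lemma common_nbrsU1 (I J : finType) (r : I -> J -> bool) (T : {set J})
  (D : {set I}) (c : I) :
  common_nbrs r (common_nbrs r T [set c]) D = common_nbrs r T (c |: D).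
Proof.
apply/setP=> x; apply/common_nbrsP/common_nbrsP.
  case=> /common_nbrsP[xT rc] rD; split=> // e /setU1P[->|]; last exact: rD.
  by apply: rc; rewrite set11.
case=> xT H; split=> [|e eD]; last by apply: H; rewrite inE eD orbT.
by apply/common_nbrsP; split=> // e /set1P->; apply: H; rewrite setU11.
Qed.

(** While C has more than b + 1 elements, move some c from C into D and shrink T to the neighbours
    of c: the avoided sums are unchanged. *)
Lemma lt_card_of_common_nbrs (I J : finType) (r : I -> J -> bool) (a b : nat)
  (C : {set I}) (T : {set J}) :
  (a <= b)%N -> (a < #|C|)%N ->
  (forall D : {set I}, D \subset C -> D != set0 ->
     ~~ (a <= #|C :\: D| + #|common_nbrs r T D| <= b)%N) ->
  (b < #|T|)%N.
Proof.
move=> leab; have [n] := ubnP #|C|.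
elim: n C T => // n IH C T ltCn ltaC avoid.
have C0 : C != set0 by rewrite -card_gt0; lia.
have [leCb|ltbC] := leqP #|C| b.+1.
  (* With this j, the window of the previous lemma becomes [[#|C|] - 1, b] for the sums, inside
     [a, b] since a < [#|C|]. *)
  suff : (#|C| + (b.+1 - #|C|) <= #|T|)%N by lia.
  apply: (@card_le_of_common_nbrs _ _ r) => // D DC D0.
  have := avoid D DC D0; have := subset_leq_card DC.
  by rewrite cardsD (setIidPr DC); lia.
have /set0Pn[c cC] := C0; have Hc := cardsD1 c C; rewrite cC in Hc.
have : (b < #|common_nbrs r T [set c]|)%N.
  apply: (IH (C :\ c)); [lia|lia|] => D DC D0.
  rewrite common_nbrsU1 setDDl; apply: avoid.
    by rewrite subUset sub1set cC (subset_trans DC) ?subsetDl.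
  by apply/set0Pn; exists c; rewrite setU11.
move=> ltb; apply: leq_trans ltb _; apply: subset_leq_card.
by apply/subsetP=> x /common_nbrsP[].
Qed.

(** * Closed sets and the converse bound *)

Definition decoding_closed (I : finType) (users : pred {set I})
  (d : {set I} -> I) (X : {set I}) : bool :=
  [forall A : {set I}, users A && (A \subset X) ==> (d A \in X)].

Lemma decoding_closedP (I : finType) (users : pred {set I})
  (d : {set I} -> I) (X : {set I}) :
  reflect (forall A : {set I}, users A -> A \subset X -> d A \in X)
    (decoding_closed users d X).
Proof.
apply: (iffP forallP) => [H A uA AX | H A]; last by apply/implyP=> /andP[]; exact: H.
by apply: (implyP (H A)); rewrite uA.
Qed.

(* Let [C] be a minimal generating set and, for [c] in [C], let [X c] be a proper
   closed set containing [C :\ c], so that [c] is not in [X c].  Intersections of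
   the [X c] are closed, so their sizes avoid [a, b], which bounds #|~: C|. *)
Lemma small_generating_set (I : finType) (a b : nat) (d : {set I} -> I) :
  let users := fun A : {set I} => (a <= #|A| <= b)%N in
  (a <= b)%N -> (forall A, users A -> d A \notin A) ->
  exists2 H : {set I}, (#|H| <= maxn a (#|I| - b.+1))%N
    & forall X, decoding_closed users d X -> H \subset X -> X = setT.
Proof.
move=> users leab dA.
pose gen := [pred H : {set I} | [forall X : {set I},
  decoding_closed users d X && (H \subset X) ==> (X == setT)]].
have genT : gen setT.
  by apply/forallP=> X; apply/implyP=> /andP[_]; rewrite subTset.
have [C /minsetP[Cgen Cmin] _] := minset_exists genT.
exists C; last first.
  by move=> X cX CX; apply/eqP; apply: (implyP (forallP Cgen X)); rewrite cX.
rewrite leq_max; case: leqP => //= ltaC.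
pose X c := odflt setT [pick X : {set I} |
  [&& decoding_closed users d X, C :\ c \subset X & X != setT]].
have XP c : c \in C -> [/\ decoding_closed users d (X c), C :\ c \subset X c
    & c \notin X c].
  move=> cC; have : ~~ gen (C :\ c).
    apply/negP=> /Cmin/(_ (subsetDl _ _)) E.
    by move: cC; rewrite -E !inE eqxx.
  rewrite negb_forall => /existsP[Y]; rewrite negb_imply => /andP[/andP[cY CY] YT].
  rewrite /X; case: pickP => [Z /and3P[cZ CZ ZT] | /(_ Y)]; last by rewrite cY CY YT.
  split=> //=; apply: contra ZT => cinZ.
  by apply: (implyP (forallP Cgen Z)); rewrite cZ -(setD1K cC) subUset sub1set cinZ.
have : (b < #|~: C|)%N.
  apply: (@lt_card_of_common_nbrs _ _ (fun c x => x \in X c) a b C) => // D DC D0.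
  pose Y := [set x | [forall (c | c \in D), x \in X c]].
  (* Each [X c] meets C exactly in [C :\ c], so Y meets C in [C :\: D]. *)
  have -> : (#|C :\: D| + #|common_nbrs (fun c x => x \in X c) (~: C) D| = #|Y|)%N.
    rewrite -(cardsID C Y); congr addn; apply: eq_card => x; rewrite !inE //.
    case: (boolP (x \in C)) => xC; rewrite ?andbF ?andbT //.
    apply/idP/forall_inP => [xD c cD | H].
      have [_ /subsetP sub _] := XP c (subsetP DC c cD).
      by apply: sub; rewrite !inE xC andbT; apply: contraNneq xD => ->.
    apply/negP=> xD; have [_ _] := XP x xC; by rewrite H.
  apply/negP=> uY; have /negP := dA Y uY; case; rewrite inE.
  apply/forall_inP=> c cD; have [/decoding_closedP cl _ _] := XP c (subsetP DC c cD).
  apply: cl uY _; apply/subsetP=> x; rewrite inE => /forall_inP; exact.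
by move=> ltb; rewrite -(cardsC C) -addnBA ?leq_addr.
Qed.

(* If [W] and [W'] are decoded correctly by all users and have the same codeword,
   then the indices where they agree form a closed set; hence such a [W] is
   determined by its codeword and its rows in a generating set [H].  Since at
   least 3/4 of all [W] are of this kind, no o(k) loss as in Fano's inequality
   arises. *)
Lemma valid_code_length (m k L : nat) (users : pred {set 'I_m}) (q : nat)
  (enc : msgs m k -> codeword L) :
  (forall d : {set 'I_m} -> 'I_m, (forall A, users A -> d A \notin A) ->
     exists2 H : {set 'I_m}, (#|H| <= q)%N
       & forall X, decoding_closed users d X -> H \subset X -> X = setT) ->
  valid_code users (2 ^ m.+2)%:R^-1 enc -> (m * k <= q * k + L)%N.
Proof.
move=> gen [dec [d valid]].
have [|H leHq Hgen] := gen d; first by move=> A /valid[].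
pose err A := [set W : msgs m k | dec A W (enc W) != row (d A) W].
pose bad := \bigcup_(A | users A) err A.
have card_err A : users A -> (#|err A| * 2 ^ m.+2 <= 2 ^ (m * k))%N.
  case/valid=> _ _; rewrite /err_prob -/(err A) ler_pdivrMr; last by rewrite ltr0n expn_gt0.
  by rewrite mulrC ler_pdivlMr ?ltr0n ?expn_gt0 // -natrM ler_nat.
(* Union bound over at most 2^m users, each with error at most 1 / 2^(m+2). *)
have card_bad : (#|bad| * 4 <= 2 ^ (m * k))%N.
  have : (#|bad| * 2 ^ m.+2 <= 2 ^ m * 2 ^ (m * k))%N.
    apply: (@leq_trans ((\sum_(A | users A) #|err A|) * 2 ^ m.+2)).
      rewrite leq_mul2r; apply/orP; right; rewrite /bad.
      elim/big_rec2: _ => [|A s B _ le_s]; first by rewrite cards0.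
      by apply: leq_trans (leq_card_setU _ _) _; rewrite leq_add2l.
    rewrite big_distrl /=; apply: (@leq_trans (\sum_(A | users A) 2 ^ (m * k))).
      exact: leq_sum.
    rewrite sum_nat_const leq_mul2r; apply/orP; right.
    have := max_card users.
    by rewrite -cardsT -powersetT card_powerset cardsT card_ord.
  have : (0 < 2 ^ m)%N by rewrite expn_gt0.
  by rewrite !expnS; nia.
have card_good : (#|~: bad| <= 2 ^ (#|H| * k + L))%N.
  pose f (W : msgs m k) := (rowsub (@enum_val _ (mem H)) W, enc W).
  have finj : {in ~: bad &, injective f}.
    move=> W W' gW gW' [eqH eqx].
    pose X := [set i | row i W == row i W'].
    have good A V : users A -> V \in ~: bad -> dec A V (enc V) = row (d A) V.
      move=> uA; rewrite inE => /bigcupP gV; apply/eqP/negPn/negP=> e.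
      by apply: gV; exists A => //; rewrite inE.
    have XT : X = setT.
      apply: Hgen.
        apply/decoding_closedP=> A uA /subsetP AX; have [_ side _] := valid A uA.
        rewrite inE -(good _ _ uA gW) -(good _ _ uA gW') eqx; apply/eqP/side => a /AX.
        by rewrite inE => /eqP.
      apply/subsetP=> i iH; rewrite inE; apply/eqP/rowP=> j; rewrite !mxE.
      have := congr1 (fun M : 'M_(_, _) => M (enum_rank_in iH i) j) eqH.
      by rewrite !mxE enum_rankK_in.
    apply/row_matrixP=> i; apply/eqP.
    by move/setP/(_ i): XT; rewrite !inE.
  apply: leq_trans (leq_card_in _ _ finj) _.
  by rewrite card_prod !card_mx card_Fp // mul1n expnD.
have := cardsC bad; rewrite card_mx card_Fp // => tot.
(* More than half of all W are good; integrality of the exponents absorbs the lost factor. *)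
have : (2 ^ (m * k) < 2 ^ (#|H| * k + L).+1)%N.
  by have : (0 < 2 ^ (m * k))%N; rewrite ?expn_gt0 // expnS; lia.
by rewrite ltn_exp2l // => lt; have := leq_mul leHq (leqnn k); lia.
Qed.


(** * Linear codes over extensions of F_2 *)

(** A message of [dim K] bits is one symbol of K. The user subtracts the known symbols and combines
    the rest by [p A], which isolates symbol [d A]. *)
Lemma valid_generator_code (K : fieldExtType 'F_2) (m r : nat)
  (users : pred {set 'I_m}) (G : 'M[K]_(r, m))
  (d : {set 'I_m} -> 'I_m) (p : {set 'I_m} -> 'rV[K]_r) :
  (forall A, users A -> [/\ d A \notin A, (p A *m G) 0 (d A) = 1
     & forall i, i \notin A -> i != d A -> (p A *m G) 0 i = 0]) ->
  exists enc : msgs m (dim K) -> codeword (r * dim K),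
    linear_enc enc /\ valid_code users 0 enc.
Proof.
move=> Gd; pose sym (W : msgs m (dim K)) i : K := r2v (row i W).
pose enc (W : msgs m (dim K)) : codeword (r * dim K) :=
  mxvec (\matrix_(j < r) v2r (\sum_i G j i * sym W i)).
exists enc; split=> [a W1 W2|].
  rewrite /enc -linearP; congr mxvec; apply/row_matrixP=> j.
  rewrite rowK linearP /= !rowK -linearP; congr v2r.
  rewrite scaler_sumr -big_split; apply: eq_bigr => i _ /=.
  by rewrite /sym !linearP mulrDr scalerAr.
exists (fun A W x => v2r (\sum_j p A 0 j *
  (r2v (row j (vec_mx x)) - \sum_(i in A) G j i * sym W i))), d => A uA.
have [dA pd p0] := Gd A uA; split=> // [W W' x eqA|].
  congr v2r; apply: eq_bigr => j _; congr (_ * (_ - _)).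
  by apply: eq_bigr => i iA; rewrite /sym eqA.
rewrite /err_prob eq_card0 ?mul0r // => W; rewrite inE; apply/negbTE/negPn/eqP.
rewrite -[RHS]r2vK -/(sym W (d A)); congr v2r; rewrite /enc.
transitivity (\sum_j p A 0 j * \sum_(i | i \notin A) G j i * sym W i).
  apply: eq_bigr => j _; rewrite mxvecK rowK v2rK; congr (_ * _).
  by rewrite (bigID (mem A)) /= addrC addrK.
transitivity (\sum_(i | i \notin A) (p A *m G) 0 i * sym W i).
  under eq_bigr do rewrite big_distrr /=.
  rewrite exchange_big; apply: eq_bigr => i _; rewrite mxE big_distrl /=.
  by apply: eq_bigr => j _; rewrite mulrA.
rewrite (bigD1 (d A)) //= pd mul1r big1 ?addr0 // => i /andP[iA id].
by rewrite p0 ?mul0r.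
Qed.

Lemma large_binary_field (m : nat) :
  exists (K : fieldExtType 'F_2) (w : 'I_m -> K), injective w.
Proof.
have [F ch cardF] := pPrimePowerField (isT : prime 2) (ltn0Sn m).
have lemF : (m <= #|F|)%N by rewrite cardF ltnW // (ltn_trans _ (ltn_expl _ _)).
pose w (i : 'I_m) : F := enum_val (widen_ord lemF i).
have winj : injective w by move=> i j /enum_val_inj [] /ord_inj.
by exists (pPrimeCharType ch), w.
Qed.

Lemma fieldExt_dim_gt0 (F : fieldType) (K : fieldExtType F) : (0 < dim K)%N.
Proof. by rewrite -dimvf adim_gt0. Qed.

Lemma odflt_pickP (T : finType) (P : pred T) (x0 : T) :
  (exists x, P x) -> P (odflt x0 [pick x | P x]).
Proof. by case=> x Px; case: pickP => [//|/(_ x)]; rewrite Px. Qed.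

Lemma mds_code (m smin smax : nat) : (smin <= smax < m)%N ->
  exists (k : nat) (enc : msgs m k -> codeword ((m - smin) * k)),
    (0 < k)%N /\ linear_enc enc /\ valid_code (@completeS_users m smin smax) 0 enc.
Proof.
case/andP=> leS ltm; have [K [w winj]] := large_binary_field m.
pose i0 : 'I_m := Ordinal (leq_ltn_trans (leq0n _) ltm).
pose d (A : {set 'I_m}) := odflt i0 [pick i | i \notin A].
(* Combining Vandermonde rows evaluates a polynomial at the points [w i]; [P A] vanishes at every
   unknown message except [d A]. *)
pose P (A : {set 'I_m}) := \prod_(x <- [seq w i | i in ~: A :\ d A]) ('X - x%:P).
pose p A : 'rV[K]_(m - smin) := \row_j ((P A)`_j / (P A).[w (d A)]).
pose G : 'M[K]_(m - smin, m) := \matrix_(j, i) w i ^+ j.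
exists (dim K); have [|enc encP] := @valid_generator_code K m _
  (@completeS_users m smin smax) G d p; last first.
  exists enc; split=> //.
  exact: fieldExt_dim_gt0.
move=> A /andP[leA geA].
have dA : d A \notin A.
  apply: (odflt_pickP (P := fun i => i \notin A)).
  apply/existsP; rewrite -negb_forall; apply/negP=> /forallP all.
  have : A = setT by apply/setP=> i; rewrite inE all.
  by move=> AT; move: geA; rewrite AT cardsT card_ord; lia.
have sizeP : (size (P A) <= m - smin)%N.
  rewrite size_prod_XsubC size_map -cardE.
  suff : (#|~: A :\ d A| < m - smin)%N by [].
  have := cardsD1 (d A) (~: A); have := cardsC A; rewrite card_ord inE dA => cA cD.
  by rewrite ltn_subRL -[ltnRHS]cA cD add1n addnS ltnS leq_add2r.
have pG i : (p A *m G) 0 i = (P A).[w i] / (P A).[w (d A)].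
  rewrite (horner_coef_wide _ sizeP) mxE big_distrl /=.
  by apply: eq_bigr => j _; rewrite !mxE mulrAC.
have rootP i : ((P A).[w i] == 0) = (i \notin A) && (i != d A).
  by rewrite -/(root _ _) root_prod_XsubC mem_image // !inE andbC.
have Pd : (P A).[w (d A)] != 0 by rewrite rootP eqxx andbF.
split=> // [|i iA id]; rewrite pG ?divff //.
have /eqP -> : (P A).[w i] == 0 by rewrite rootP iA.
by rewrite mul0r.
Qed.

Lemma uncoded_code (m smin smax : nat) : (smax < m)%N ->
  exists (k : nat) (enc : msgs m k -> codeword (smax.+1 * k)),
    (0 < k)%N /\ linear_enc enc /\ valid_code (@completeS_users m smin smax) 0 enc.
Proof.
(* Any extension of F_2 serves here, so zero distinct points are requested. *)
move=> ltm; have [K _] := large_binary_field 0.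
pose i0 : 'I_m := Ordinal (leq_ltn_trans (leq0n _) ltm).
pose d (A : {set 'I_m}) := odflt i0 [pick i : 'I_m | (i < smax.+1)%N && (i \notin A)].
pose p (A : {set 'I_m}) : 'rV[K]_smax.+1 := delta_mx 0 (inord (d A)).
pose G : 'M[K]_(smax.+1, m) := \matrix_(j, i) (j == i :> nat)%:R.
exists (dim K); have [|enc encP] := @valid_generator_code K m _
  (@completeS_users m smin smax) G d p; last first.
  by exists enc; split=> //; exact: fieldExt_dim_gt0.
move=> A /andP[_ geA].
have /andP[dS dA] : (d A < smax.+1)%N && (d A \notin A).
  apply: (odflt_pickP (P := fun i : 'I_m => (i < smax.+1)%N && (i \notin A))).
  apply/existsP; move: geA; apply: contraTT; rewrite negb_exists -ltnNge => /forallP all.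
  have inj : injective (widen_ord ltm) by move=> i j [] /ord_inj.
  rewrite -[X in (X <= _)%N](card_ord smax.+1) -(card_codom inj).
  apply: subset_leq_card; apply/subsetP=> _ /codomP[i ->].
  by have := all (widen_ord ltm i); rewrite negb_and negbK (ltn_ord i).
have pG i : (p A *m G) 0 i = (d A == i)%:R.
  by rewrite -rowE !mxE inordK.
by split=> // [|i iA id]; rewrite pG ?eqxx // eq_sym (negbTE id).
Qed.

Theorem theorem1 (m smin smax : nat) :
  (1 <= m)%N -> (smin <= smax)%N -> (smax <= m - 1)%N ->
  let lstar := minn (m - smin) smax.+1 in
  (* lstar is a lower bound on every achievable normalized length *)
  (forall ell : rat, achievable (@completeS_users m smin smax) ell ->
     (lstar%:R <= ell)) /\
  (* lstar is achieved by a zero-error linear code *)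
  (exists (k : nat) (enc : msgs m k -> codeword (lstar * k)%N),
     (0 < k)%N /\ linear_enc enc /\
     valid_code (@completeS_users m smin smax) 0 enc).
Proof.
move=> m_gt0 leS lem lstar; have ltm : (smax < m)%N by lia.
split=> [ell ach|]; last first.
  rewrite /lstar; case: leqP => _; last exact: uncoded_code.
  by apply: mds_code; rewrite leS.
have [|k [L [enc [k_gt0 [leL valid]]]]] := ach (2 ^ m.+2)%:R^-1.
  by rewrite invr_gt0 ltr0n expn_gt0.
have len : (m * k <= maxn smin (m - smax.+1) * k + L)%N.
  apply: valid_code_length valid => d dA.
  have [H leH genH] := small_generating_set leS dA; exists H => //.
  by rewrite card_ord in leH.
have leLk : (lstar * k <= L)%N.
  (* The messages given away and [lstar] add up to m. *)
  have : (m = lstar + maxn smin (m - smax.+1))%N by rewrite /lstar; lia.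
  by move: len => /[swap] {1}->; rewrite mulnDl; lia.
rewrite -(ler_pM2r (x := k%:R)) ?ltr0n // -natrM; apply: le_trans leL.
by rewrite ler_nat.
Qed.
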